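(* Let $(M,g)$ be a Lorentzian manifold of dimension $n\ge3$, $c$ a null congruence on $M$, and $S_{ab}=S_{ba}$ a rank 2 symmetric tensor field of type III with boost order $-1$ along $c$, i.e. $\mathrm{bo}_c(S)=-1$ (at every point). If $\mathrm{bo}_c(\nabla S)\le 0$, then $c$ is geodetic. If moreover $\mathrm{bo}_c(\nabla\nabla S)\le0$, then $c$ is Kundt.
   Context: Lorentzian metrics have signature $(-,+,\dots,+)$ and $\nabla$ is the Levi-Civita connection. A null congruence $c$ (equivalently null line distribution) is a smooth rank-one subbundle of $TM$ whose fibres are null lines. With $k$ a local non-vanishing section of $c$: $c$ is geodetic if $k^a\nabla_ak^b\propto k^b$; $c$ is Kundt (non-twisting, hence geodetic, non-shearing and non-expanding) if $X^a\nabla_ak^b\propto k^b$ for all $X\in c^\perp$, equivalently $k_{[a}\nabla_{b]}k_{[c}k_{d]}=0$. Boost order: at each point take a null frame $\{e_0,e_1,e_i\}=\{k,l,m_i\}$ ($2\le i\le n-1$) with $0\ne k\in c$, whose only non-zero inner products are $g(k,l)=g(m_i,m_i)=1$. The boost weight of a multi-index $\alpha_1\cdots\alpha_r$ is (number of $0$'s) minus (number of $1$'s). The boost order $\mathrm{bo}_c(T)$ of a non-zero covariant tensor $T$ is the largest boost weight of a multi-index with $T_{\alpha_1\cdots\alpha_r}=T(e_{\alpha_1},\dots,e_{\alpha_r})\ne0$ (independent of the frame); the zero tensor is regarded as having boost order $\le s$ for every $s$. Conditions on boost orders of tensor fields are meant at every point. A symmetric rank 2 tensor is of type III exactly when it has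 boost order $-1$ along some (then unique) null line. *)

(* Defs.v *)
(* MathComp / MathComp-Analysis. *)
From mathcomp Require Import all_boot all_order all_algebra.
From mathcomp Require Import all_classical all_reals all_analysis.
From mathcomp Require Import ring lra.

Set Implicit Arguments.
Unset Strict Implicit.
Unset Printing Implicit Defensive.

Import Order.TTheory GRing.Theory Num.Theory.
Import numFieldNormedType.Exports.

Local Open Scope classical_set_scope.
Local Open Scope ring_scope.

(* Vectors of R^n are row vectors, indices run over 0, ..., n-1. *)
Definition partial (R : realType) (n : nat) (W : normedModType R) (i : 'I_n)
    (f : 'rV[R]_n -> W) : 'rV[R]_n -> W :=
  'D_(delta_mx 0 i) f.

(* C^oo on an open set A: every iterated partial derivative (of any order,
   including f itself) is differentiable at every point of A. *)
Definition smooth_on (R : realType) (n : nat) (W : normedModType R)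
    (A : set 'rV[R]_n) (f : 'rV[R]_n -> W) : Prop :=
  forall (s : seq 'I_n) (x : 'rV[R]_n), A x ->
    differentiable (foldr (fun i h => partial i h) f s) x.

(* The smooth structure is given by an atlas, which need not be maximal.
   [chart_coord u] and [chart_param u] are total functions that are only meaningful on
   [chart_dom u] and on [chart_coord u @` chart_dom u] respectively. *)
Record smoothManifold (R : realType) (n : nat) := SmoothManifold {
  point_of :> topologicalType;
  chart : Type;
  chart_dom : chart -> set point_of;
  chart_coord : chart -> point_of -> 'rV[R]_n;
  chart_param : chart -> 'rV[R]_n -> point_of;
  manifold_hausdorff : hausdorff_space point_of;
  manifold_second_countable : @second_countable point_of;
  atlas_cover : forall p : point_of, exists u, chart_dom u p;
  chart_dom_open : forall u, open (chart_dom u);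
  chart_image_open : forall u, open (chart_coord u @` chart_dom u);
  chart_coordK : forall u p, chart_dom u p -> chart_param u (chart_coord u p) = p;
  chart_coord_continuous : forall u, {within chart_dom u, continuous (chart_coord u)};
  chart_param_continuous : forall u,
    {within chart_coord u @` chart_dom u, continuous (chart_param u)};
  transition_smooth : forall u v,
    smooth_on (chart_coord u @` (chart_dom u `&` chart_dom v)) (chart_coord v \o chart_param u)
}.

Definition chart_image (R : realType) (n : nat) (M : smoothManifold R n)
    (u : chart M) : set 'rV[R]_n :=
  chart_coord u @` chart_dom u.

Definition transition (R : realType) (n : nat) (M : smoothManifold R n)
    (u v : chart M) : 'rV[R]_n -> 'rV[R]_n :=
  chart_coord v \o chart_param u.

(* A field of rank r covariant tensors: its components in the coordinate
   frame of the chart u, at the point with coordinates x, indexed by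
   multi-indices. *)
Definition tfield (R : realType) (n : nat) (M : smoothManifold R n) (r : nat) :=
  chart M -> 'rV[R]_n -> r.-tuple 'I_n -> R.

(* T(e_(alpha_1), ..., e_(alpha_r)), where e_i is the i-th row of e. *)
Definition frame_comp (R : realType) (n r : nat) (e : 'M[R]_n)
    (T : r.-tuple 'I_n -> R) (alpha : r.-tuple 'I_n) : R :=
  \sum_(beta : r.-tuple 'I_n)
    T beta * \prod_(s < r) e (tnth alpha s) (tnth beta s).

(* Row a of the Jacobian ['J (transition u v) x] expresses the coordinate
   vector d/dx^a of u in the coordinate frame of v. *)
Record tensor_field (R : realType) (n : nat) (M : smoothManifold R n) (r : nat)
    (T : tfield M r) : Prop := TensorField {
  tensor_smooth : forall u alpha, smooth_on (chart_image u) (fun x => T u x alpha);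
  tensor_transform : forall u v p alpha, chart_dom u p -> chart_dom v p ->
    T u (chart_coord u p) alpha =
    frame_comp ('J (transition u v) (chart_coord u p)) (T v (chart_coord v p)) alpha
}.

Definition symmetric2 (R : realType) (n : nat) (M : smoothManifold R n)
    (T : tfield M 2) : Prop :=
  forall u x a b, chart_image u x -> T u x [tuple a; b] = T u x [tuple b; a].

Definition gram (R : realType) (n : nat) (M : smoothManifold R n)
    (g : tfield M 2) (u : chart M) (x : 'rV[R]_n) : 'M[R]_n :=
  \matrix_(a, b) g u x [tuple a; b].

Definition inner (R : realType) (n : nat) (M : smoothManifold R n)
    (g : tfield M 2) (u : chart M) (x X Y : 'rV[R]_n) : R :=
  (X *m gram g u x *m Y^T) 0 0.

Record lorentzian_metric (R : realType) (n : nat) (M : smoothManifold R n)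
    (g : tfield M 2) : Prop := LorentzianMetric {
  lorentzian_tensor : tensor_field g;
  lorentzian_sym : symmetric2 g;
  lorentzian_signature : forall u x, chart_image u x ->
    exists2 P : 'M[R]_n, P \in unitmx &
      P *m gram g u x *m P^T =
      \matrix_(i, j) (if i == j then if i == 0%N :> nat then -1 else 1 else 0)
}.

(* Gamma^d_(ab) of the Levi-Civita connection. *)
Definition christoffel (R : realType) (n : nat) (M : smoothManifold R n)
    (g : tfield M 2) (u : chart M) (x : 'rV[R]_n) (d a b : 'I_n) : R :=
  2^-1 * \sum_(e < n) invmx (gram g u x) d e *
    (partial a (fun y => g u y [tuple b; e]) x
     + partial b (fun y => g u y [tuple a; e]) x
     - partial e (fun y => g u y [tuple a; b]) x).

(* (nabla T)_(a b_1 ... b_r) = nabla_a T_(b_1 ... b_r): the index of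
   differentiation comes first. *)
Definition cov_deriv (R : realType) (n : nat) (M : smoothManifold R n)
    (g : tfield M 2) (r : nat) (T : tfield M r) : tfield M r.+1 :=
  fun u x alpha =>
    let a := thead alpha in
    let beta : r.-tuple 'I_n := [tuple of behead alpha] in
    partial a (fun y => T u y beta) x
    - \sum_(s < r) \sum_(d < n) christoffel g u x d a (tnth beta s) *
        T u x [tuple if t == s then d else tnth beta t | t < r].

(* The two properties that characterize the Levi-Civita connection: it is
   torsion-free ([christoffel_sym]) and metric ([cov_deriv_metric]). *)
Lemma partial_metric_sym (R : realType) (n : nat) (M : smoothManifold R n)
    (g : tfield M 2) (hg : lorentzian_metric g)
    (u : chart M) (x : 'rV[R]_n) (a b e : 'I_n) : chart_image u x ->
  partial a (fun y => g u y [tuple b; e]) x =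
  partial a (fun y => g u y [tuple e; b]) x.
Proof.
move=> ux; apply: near_eq_derive.
have : nbhs x (chart_image u) by apply: open_nbhs_nbhs; split=> //; exact: chart_image_open.
by apply: filterS => y uy /=; apply: (lorentzian_sym hg).
Qed.

Lemma christoffel_sym (R : realType) (n : nat) (M : smoothManifold R n)
    (g : tfield M 2) (hg : lorentzian_metric g)
    (u : chart M) (x : 'rV[R]_n) (d a b : 'I_n) : chart_image u x ->
  christoffel g u x d a b = christoffel g u x d b a.
Proof.
move=> ux; rewrite /christoffel; congr (_ * _); apply: eq_bigr => e _.
by rewrite (partial_metric_sym hg e a b ux); ring.
Qed.

Lemma gram_unit (R : realType) (n : nat) (M : smoothManifold R n)
    (g : tfield M 2) (hg : lorentzian_metric g)
    (u : chart M) (x : 'rV[R]_n) : chart_image u x -> gram g u x \in unitmx.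
Proof.
move=> ux; have [P Pu PG] := lorentzian_signature hg ux.
set D := (X in _ = X) in PG.
have : D *m D = 1%:M.
  apply/matrixP => i j; rewrite !mxE (bigD1 i)//= big1 => [|k ki]; last first.
    by rewrite !mxE eq_sym (negbTE ki) mul0r.
  by rewrite !mxE eqxx addr0; case: (i == j); case: (i == 0%N :> nat);
    rewrite ?mulr0 ?mulrN ?mulr1 ?opprK.
move=> /mulmx1_unit[]; rewrite -PG => Du _.
by move: Du; rewrite !unitmx_mul => /andP[/andP[]].
Qed.

Lemma cov_deriv_metric (R : realType) (n : nat) (M : smoothManifold R n)
    (g : tfield M 2) (hg : lorentzian_metric g)
    (u : chart M) (x : 'rV[R]_n)
    (alpha : 3.-tuple 'I_n) : chart_image u x -> cov_deriv g g u x alpha = 0.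
Proof.
move=> ux; have := gram_unit hg ux; set G := gram g u x => Gu.
case/tupleP: alpha => a /= alpha; case/tupleP: alpha => b alpha.
case/tupleP: alpha => c alpha; rewrite (tuple0 alpha) {alpha}.
have Gs i j : G i j = G j i by rewrite !mxE (lorentzian_sym hg).
have lower (F : 'I_n -> R) k :
    \sum_(d < n) (\sum_(e < n) invmx G d e * F e) * G d k = F k.
  transitivity (\sum_(e < n) \sum_(d < n) (G k d * invmx G d e) * F e).
    rewrite exchange_big; apply: eq_bigr => d _; rewrite mulr_suml.
    by apply: eq_bigr => e _; rewrite (Gs d k); ring.
  under eq_bigr => e _.
    rewrite -mulr_suml.
    have -> : \sum_(d < n) G k d * invmx G d e = (G *m invmx G) k e by rewrite mxE.
    rewrite mulmxV // mxE; over.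
  by rewrite (bigD1 k)//= eqxx mul1r big1 ?addr0// => e ek;
    rewrite eq_sym (negbTE ek) mul0r.
rewrite /cov_deriv !big_ord_recl big_ord0 addr0.
set f := (X in partial _ X).
have -> : f = fun y => g u y [tuple b; c].
  by apply/funext => y; congr (g u y _); apply: val_inj.
set s0 := (X in _ - (X + _)); set s1 := (X in _ - (_ + X)).
have -> : s0 = 2^-1 * \sum_(d < n) (\sum_(e < n) invmx G d e *
  (partial a (fun y => g u y [tuple b; e]) x
     + partial b (fun y => g u y [tuple a; e]) x
     - partial e (fun y => g u y [tuple a; b]) x)) * G d c.
  rewrite mulr_sumr; apply: eq_bigr => d _; rewrite mulrA mxE; congr (_ * _).
  by congr (g u x _); apply: eq_from_tnth => i; rewrite !tnth_mktuple;
    case: i => -[|[|[]]].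
have -> : s1 = 2^-1 * \sum_(d < n) (\sum_(e < n) invmx G d e *
  (partial a (fun y => g u y [tuple c; e]) x
     + partial c (fun y => g u y [tuple a; e]) x
     - partial e (fun y => g u y [tuple a; c]) x)) * G d b.
  rewrite mulr_sumr; apply: eq_bigr => d _; rewrite mulrA Gs mxE; congr (_ * _).
  by congr (g u x _); apply: eq_from_tnth => i; rewrite !tnth_mktuple;
    case: i => -[|[|[]]].
have -> : thead [tuple of a :: [tuple of b :: [tuple of [:: c]]]] = a by [].
rewrite !lower (partial_metric_sym hg a c b ux); lra.
Qed.

(* nabla_X k at x, for a vector field k given in the chart u. *)
Definition cov_deriv_vec (R : realType) (n : nat) (M : smoothManifold R n)
    (g : tfield M 2) (u : chart M) (X : 'rV[R]_n) (k : 'rV[R]_n -> 'rV[R]_n)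
    (x : 'rV[R]_n) : 'rV[R]_n :=
  'D_X k x
  + \row_b \sum_(a < n) \sum_(d < n) christoffel g u x b a d * X 0 a * k x 0 d.

(* A distribution: a set of tangent vectors at each point, given by their
   components in each chart. *)
Definition distribution_field (R : realType) (n : nat)
    (M : smoothManifold R n) :=
  chart M -> 'rV[R]_n -> set 'rV[R]_n.

Definition local_section (R : realType) (n : nat) (M : smoothManifold R n)
    (c : distribution_field M) (u : chart M) (V : set 'rV[R]_n)
    (k : 'rV[R]_n -> 'rV[R]_n) : Prop :=
  [/\ open V, V `<=` chart_image u, smooth_on V k &
      forall y, V y -> k y != 0 /\ c u y (k y)].

Record null_congruence (R : realType) (n : nat) (M : smoothManifold R n)
    (g : tfield M 2) (c : distribution_field M) : Prop := NullCongruence {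
  congruence_transform : forall u v p X, chart_dom u p -> chart_dom v p ->
    c u (chart_coord u p) X ->
    c v (chart_coord v p) (X *m 'J (transition u v) (chart_coord u p));
  congruence_line : forall u x, chart_image u x ->
    exists (V : set 'rV[R]_n) (k : 'rV[R]_n -> 'rV[R]_n),
      [/\ V x, local_section c u V k &
          forall y, V y -> c u y = [set a *: k y | a in [set: R]]];
  congruence_null : forall u x X, chart_image u x -> c u x X -> inner g u x X X = 0
}.

Definition geodetic (R : realType) (n : nat) (M : smoothManifold R n)
    (g : tfield M 2) (c : distribution_field M) : Prop :=
  forall u V k, local_section c u V k -> forall x, V x ->
    exists a : R, cov_deriv_vec g u (k x) k x = a *: k x.

Definition kundt (R : realType) (n : nat) (M : smoothManifold R n)
    (g : tfield M 2) (c : distribution_field M) : Prop :=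
  forall u V k, local_section c u V k -> forall x, V x ->
  forall X : 'rV[R]_n, (forall Y, c u x Y -> inner g u x X Y = 0) ->
    exists a : R, cov_deriv_vec g u X k x = a *: k x.

(* The rows of e are e_0 = k, e_1 = l, e_i = m_i (i >= 2). *)
Definition null_frame (R : realType) (n : nat) (G : 'M[R]_n)
    (L : set 'rV[R]_n) (e : 'M[R]_n) : Prop :=
  [/\ e \in unitmx,
      forall i : 'I_n, i = 0%N :> nat -> L (row i e) &
      e *m G *m e^T =
        \matrix_(i, j) ([|| (i == 0%N :> nat) && (j == 1%N :> nat),
                            (i == 1%N :> nat) && (j == 0%N :> nat) |
                            (2 <= i)%N && (i == j)])%:R].

Definition boost_weight (n r : nat) (alpha : r.-tuple 'I_n) : int :=
  (count (fun i : 'I_n => i == 0%N :> nat) alpha)%:Z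
  - (count (fun i : 'I_n => i == 1%N :> nat) alpha)%:Z.

(* The boost order along L is at most s; it does not depend on the null frame,
   and the zero tensor satisfies this for every s. *)
Definition bo_le (R : realType) (n r : nat) (G : 'M[R]_n) (L : set 'rV[R]_n)
    (T : r.-tuple 'I_n -> R) (s : int) : Prop :=
  forall e, null_frame G L e -> forall alpha,
    frame_comp e T alpha != 0 -> boost_weight alpha <= s.

Definition bo_eq (R : realType) (n r : nat) (G : 'M[R]_n) (L : set 'rV[R]_n)
    (T : r.-tuple 'I_n -> R) (s : int) : Prop :=
  bo_le G L T s /\
  exists e alpha, [/\ null_frame G L e, frame_comp e T alpha != 0 &
                      boost_weight alpha = s].

Definition field_bo_le (R : realType) (n r : nat) (M : smoothManifold R n)
    (g : tfield M 2) (c : distribution_field M) (T : tfield M r) (s : int) :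
    Prop :=
  forall u x, chart_image u x -> bo_le (gram g u x) (c u x) (T u x) s.

Definition field_bo_eq (R : realType) (n r : nat) (M : smoothManifold R n)
    (g : tfield M 2) (c : distribution_field M) (T : tfield M r) (s : int) :
    Prop :=
  forall u x, chart_image u x -> bo_eq (gram g u x) (c u x) (T u x) s.

(* Main.v *)
Require Import Defs.
From mathcomp Require Import all_boot all_order all_algebra.
From mathcomp Require Import all_classical all_reals all_analysis.
From mathcomp Require Import perm ring lra.

(** Let k be a local section of c and write K = nabla_X k. Since k is null, K is
orthogonal to k. Boost order -1 means that S(k, .) = 0 and S(Y, Z) = 0 for all
Y, Z orthogonal to k, so with any l such that g(l, k) = 1,
  S(W, Z) = g(W, k) S(l, Z)   for Z orthogonal to k          ([typeIII_split]).
The vector v dual to S(l, .) is orthogonal to k; it is spacelike, for otherwise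
it would be a multiple of k and S would vanish ([exists_spacelike]).

Differentiating S(., k) = 0 and S(Y, Z) = 0 along X gives the components of nabla S
in terms of K:
  (nabla_X S)(W, k) = - S(W, K)                              ([nablaS_section]),
  (nabla_X S)(Y, Z) = g(Y, K) S(l, Z) + g(Z, K) S(l, Y)      ([nablaS_orth])
for Y, Z orthogonal to k. In both parts the boost order condition is turned into
the identity
  2 g(Z, K) S(l, K) + g(K, K) S(l, Z) = 0   for all Z orthogonal to k.
At Z = v it reads 2 g(v, K)^2 + g(K, K) g(v, v) = 0, a sum of nonnegative terms.
So K is null and orthogonal to k, hence proportional to k
([cov_section_proportional]).

For the geodetic part X = k, and (nabla_k S)(Y, Z) has boost weight at least 1,
so that the second formula vanishes for all Y, Z orthogonal to k. Taking Y = K,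
then Y = Z = K, makes both terms of the identity vanish.

For the Kundt part X is orthogonal to k, and (nabla_X nabla S)(X, Z, k) has boost
weight at least 1. By the first formula the function (nabla_X S)(Z, k) is zero
whenever Z is a vector field orthogonal to k, so the Leibniz rule expresses
(nabla_X nabla S)(X, Z, k) by values of nabla S alone; these are given by the two
formulas, and no second derivative of k appears ([section_kundt]).

Everything is computed in one chart. Covariant derivatives enter only through
the Leibniz rule [derive_tensor_eval] for the evaluation of a tensor field on
vector fields, and bounds on boost orders only through [section_bo_le], which replaces the
components in a null frame by arguments that are k, orthogonal to k, or
arbitrary. *)

Import Order.TTheory GRing.Theory Num.Theory.
Import numFieldNormedType.Exports.

Local Open Scope classical_set_scope.
Local Open Scope ring_scope.

Set Implicit Arguments.
Unset Strict Implicit.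
Unset Printing Implicit Defensive.

(** * Derivatives of finite sums and products *)

Section BigDerivatives.
Variables (R : realType) (V : normedModType R) (I : Type).
Implicit Types (x v : V) (s : seq I).

Lemma is_derive_bigsum s (f : I -> V -> R) (df : I -> R) x v :
  (forall i, is_derive x v (f i) (df i)) ->
  is_derive x v (fun y => \sum_(i <- s) f i y) (\sum_(i <- s) df i).
Proof.
move=> dfx; elim: s => [|i s IHs].
  rewrite big_nil (_ : (fun y => _) = cst 0); first exact: is_derive_cst.
  by apply/funext => y; rewrite big_nil.
rewrite big_cons (_ : (fun y => _) = f i + (fun y => \sum_(i <- s) f i y)).
  exact: is_deriveD.
by apply/funext => y; rewrite big_cons.
Qed.

Lemma differentiable_bigsum s (f : I -> V -> R) x :
  (forall i, differentiable (f i) x) ->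
  differentiable (fun y => \sum_(i <- s) f i y) x.
Proof.
move=> fx; elim: s => [|i s IHs].
  rewrite (_ : (fun y => _) = cst 0); first exact: differentiable_cst.
  by apply/funext => y; rewrite big_nil.
rewrite (_ : (fun y => _) = f i + (fun y => \sum_(i <- s) f i y)).
  exact: differentiableD.
by apply/funext => y; rewrite big_cons.
Qed.

Lemma differentiable_bigprod s (f : I -> V -> R) x :
  (forall i, differentiable (f i) x) ->
  differentiable (fun y => \prod_(i <- s) f i y) x.
Proof.
move=> fx; elim: s => [|i s IHs].
  rewrite (_ : (fun y => _) = cst 1); first exact: differentiable_cst.
  by apply/funext => y; rewrite big_nil.
rewrite (_ : (fun y => _) = f i * (fun y => \prod_(i <- s) f i y)).
  exact: differentiableM.
by apply/funext => y; rewrite big_cons.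
Qed.

End BigDerivatives.

Lemma is_derive_prod (R : realType) (V : normedModType R) (r : nat)
    (f : 'I_r -> V -> R) (df : 'I_r -> R) (x v : V) :
  (forall i, is_derive x v (f i) (df i)) ->
  is_derive x v (fun y => \prod_(i < r) f i y)
    (\sum_(i < r) df i * \prod_(j < r | j != i) f j x).
Proof.
elim: r f df => [|r IHr] f df dfx.
  rewrite big_ord0 (_ : (fun y => _) = cst 1); first exact: is_derive_cst.
  by apply/funext => y; rewrite big_ord0.
rewrite (_ : (fun y => _) =
    f ord0 * (fun y => \prod_(i < r) f (lift ord0 i) y)); last first.
  by apply/funext => y; rewrite big_ord_recl.
have dl := IHr _ _ (fun i => dfx (lift ord0 i)).
have d0 := dfx ord0.
apply: is_derive_eq; rewrite big_ord_recl addrC /=; congr (_ + _).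
  rewrite /GRing.scale /= mulrC; congr (_ * _).
  by rewrite [RHS]big_mkcond big_ord_recl /= mul1r.
rewrite /GRing.scale /= mulr_sumr; apply: eq_bigr => i _.
rewrite mulrCA; congr (_ * _).
rewrite [RHS]big_mkcond big_ord_recl /=; congr (_ * _).
by rewrite [LHS]big_mkcond /=.
Qed.

(** * Evaluation of covariant tensors on vectors *)

Section TensorEvaluation.
Variables (R : realType) (n : nat).
Implicit Types (X Y W : 'rV[R]_n) (Ys : seq 'rV[R]_n).

Definition tensor_eval r (T : r.-tuple 'I_n -> R) Ys : R :=
  \sum_(beta : r.-tuple 'I_n) T beta * \prod_(s < r) (nth 0 Ys s) 0 (tnth beta s).

Lemma frame_compE r (e : 'M[R]_n) (T : r.-tuple 'I_n -> R) alpha :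
  frame_comp e T alpha = tensor_eval T [seq row i e | i <- alpha].
Proof.
apply: eq_bigr => beta _; congr (_ * _); apply: eq_bigr => s _.
by rewrite (nth_map (tnth alpha s)) ?size_tuple// -tnth_nth mxE.
Qed.

Lemma sum_tupleS r (F : r.+1.-tuple 'I_n -> R) :
  \sum_alpha F alpha =
  \sum_(a < n) \sum_(beta : r.-tuple 'I_n) F [tuple of a :: beta].
Proof.
rewrite pair_big /=.
rewrite (reindex (fun p : 'I_n * r.-tuple 'I_n => [tuple of p.1 :: p.2])) //=.
exists (fun t => (thead t, [tuple of behead t])) => [[a b] _|t _] /=.
  by congr (_, _); apply: val_inj.
by rewrite -tuple_eta.
Qed.

Lemma tensor_eval_cons r (T : r.+1.-tuple 'I_n -> R) X Ys :
  tensor_eval T (X :: Ys) =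
  \sum_(a < n) X 0 a * tensor_eval (fun beta => T [tuple of a :: beta]) Ys.
Proof.
rewrite /tensor_eval sum_tupleS; apply: eq_bigr => a _.
rewrite mulr_sumr; apply: eq_bigr => beta _.
rewrite big_ord_recl /= tnth0 mulrCA; congr (_ * (_ * _)).
by apply: eq_bigr => s _; rewrite tnthS.
Qed.

Lemma tensor_eval2 (T : 2.-tuple 'I_n -> R) X Y :
  tensor_eval T [:: X; Y] = \sum_(a < n) \sum_(b < n) X 0 a * Y 0 b * T [tuple a; b].
Proof.
rewrite tensor_eval_cons; apply: eq_bigr => a _.
rewrite tensor_eval_cons mulr_sumr; apply: eq_bigr => b _.
rewrite /tensor_eval (big_pred1 [tuple]) => [|t]; last by rewrite [t]tuple0 /= eqxx.
by rewrite big_ord0 mulr1 mulrA; congr (_ * _ * T _); exact: val_inj.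
Qed.

Lemma tensor_eval_set_nth r (T : r.-tuple 'I_n -> R) Ys (s : 'I_r) W :
  tensor_eval T (set_nth 0 Ys s W) =
  \sum_(beta : r.-tuple 'I_n)
    T beta * (W 0 (tnth beta s) *
      \prod_(t < r | t != s) (nth 0 Ys t) 0 (tnth beta t)).
Proof.
apply: eq_bigr => beta _; rewrite (bigD1 s) //= nth_set_nth /= eqxx.
congr (_ * (_ * _)); apply: eq_bigr => t ts.
by rewrite nth_set_nth /= (inj_eq val_inj) (negbTE ts).
Qed.

Definition tuple_upd r (beta : r.-tuple 'I_n) (s : 'I_r) (d : 'I_n) : r.-tuple 'I_n :=
  [tuple if t == s then d else tnth beta t | t < r].

(** The map that exchanges [d] with entry [s] of [beta] is an involution of the
pairs ([beta], [d]). *)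
Lemma sum_tuple_upd r (s : 'I_r) (F : r.-tuple 'I_n -> 'I_n -> 'I_n -> R) :
  \sum_beta \sum_(d < n) F (tuple_upd beta s d) d (tnth beta s) =
  \sum_beta \sum_(d < n) F beta (tnth beta s) d.
Proof.
rewrite !pair_big /=.
pose swap (p : r.-tuple 'I_n * 'I_n) := (tuple_upd p.1 s p.2, tnth p.1 s).
have swapK : involutive swap.
  move=> [beta d]; rewrite /swap /= tnth_mktuple eqxx; congr (_, _).
  apply: eq_from_tnth => t; rewrite !tnth_mktuple.
  by case: eqP => [->|].
rewrite (reindex_inj (inv_inj swapK)) /=; apply: eq_bigr => -[beta d] _ /=.
have /(congr1 fst) /= -> := swapK (beta, d).
by rewrite tnth_mktuple eqxx.
Qed.

(** Contracting one slot of [T] with an endomorphism amounts to applying its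
transpose to the vector in that slot; for the Christoffel symbols this turns the
correction terms of [cov_deriv] into those of [cov_deriv_vec]. *)
Lemma tensor_eval_contract r (T : r.-tuple 'I_n -> R) (Gam : 'I_n -> 'I_n -> R)
    Ys (s : 'I_r) :
  tensor_eval
    (fun beta => \sum_(d < n) Gam d (tnth beta s) * T (tuple_upd beta s d)) Ys =
  tensor_eval T (set_nth 0 Ys s (\row_b \sum_(d < n) Gam b d * (nth 0 Ys s) 0 d)).
Proof.
rewrite tensor_eval_set_nth /tensor_eval.
pose F beta b d := Gam b d * T beta * ((nth 0 Ys s) 0 d *
   \prod_(t < r | t != s) (nth 0 Ys t) 0 (tnth beta t)).
transitivity (\sum_beta \sum_(d < n) F (tuple_upd beta s d) d (tnth beta s)).
  apply: eq_bigr => beta _; rewrite mulr_suml; apply: eq_bigr => d _.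
  rewrite /F (bigD1 s) //=; congr (_ * (_ * _)); apply: eq_bigr => t ts.
  by rewrite tnth_mktuple (negbTE ts).
rewrite sum_tuple_upd; apply: eq_bigr => beta _.
rewrite mxE mulr_suml mulr_sumr; apply: eq_bigr => d _; rewrite /F; ring.
Qed.

End TensorEvaluation.

(** * The Leibniz rule for covariant derivatives *)

Section Leibniz.
Variables (R : realType) (n : nat).

Lemma derive_partial (f : 'rV[R]_n -> R) (x X : 'rV[R]_n) : differentiable f x ->
  'D_X f x = \sum_(a < n) X 0 a * partial a f x.
Proof.
move=> fx; rewrite deriveE// {1}(row_sum_delta X) linear_sum.
by apply: eq_bigr => a _; rewrite linearZ /partial deriveE.
Qed.

Lemma derive_row (Y : 'rV[R]_n -> 'rV[R]_n) (x X : 'rV[R]_n) (b : 'I_n) :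
  differentiable Y x -> is_derive x X (fun y => Y y 0 b) (('D_X Y x) 0 b).
Proof.
move=> Yx; have dY : derivable Y x X by exact: diff_derivable.
rewrite derive_mx// mxE; apply: derivableP.
exact: (derivable_mxP _ _ _).1.
Qed.

Lemma differentiable_row (Y : 'rV[R]_n -> 'rV[R]_n) (x : 'rV[R]_n) (b : 'I_n) :
  differentiable Y x -> differentiable (fun y => Y y 0 b) x.
Proof.
move=> Yx; rewrite (_ : (fun y => _) = (fun N : 'rV[R]_n => N 0 b) \o Y) //.
by apply: differentiable_comp => //; exact: differentiable_coord.
Qed.

Lemma differentiable_tensor_eval r (T : 'rV[R]_n -> r.-tuple 'I_n -> R)
    (Ys : seq ('rV[R]_n -> 'rV[R]_n)) (x : 'rV[R]_n) : size Ys = r ->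
  (forall beta, differentiable (fun y => T y beta) x) ->
  (forall s : 'I_r, differentiable (nth (cst 0) Ys s) x) ->
  differentiable (fun y => tensor_eval (T y) [seq Y y | Y <- Ys]) x.
Proof.
move=> sz Tx Yx; apply: differentiable_bigsum => beta.
apply: differentiableM => //; apply: differentiable_bigprod => s.
rewrite (_ : (fun y => _) = fun y => (nth (cst 0) Ys s) y 0 (tnth beta s)).
  exact: differentiable_row.
by apply/funext => y; rewrite (nth_map (cst 0)) ?sz.
Qed.

Lemma cov_derivE (M : smoothManifold R n) (g : tfield M 2) r (T : tfield M r)
    (u : chart M) (x : 'rV[R]_n) (a : 'I_n) (beta : r.-tuple 'I_n) :
  cov_deriv g T u x [tuple of a :: beta] =
  partial a (fun y => T u y beta) x -
  \sum_(s < r) \sum_(d < n)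
    christoffel g u x d a (tnth beta s) * T u x (tuple_upd beta s d).
Proof.
rewrite /cov_deriv.
rewrite (_ : [tuple of behead [tuple of a :: beta]] = beta :> r.-tuple 'I_n) //.
exact: val_inj.
Qed.

(** The ordinary product rule gives the directional derivatives of the components
of [T] and of the vector fields; the Christoffel terms of [cov_deriv] in each slot
cancel those of [cov_deriv_vec], by [tensor_eval_contract]. *)
Lemma derive_tensor_eval (M : smoothManifold R n) (g : tfield M 2) r (T : tfield M r)
    (u : chart M) (Ys : seq ('rV[R]_n -> 'rV[R]_n)) (x X : 'rV[R]_n) :
  size Ys = r ->
  (forall beta, differentiable (fun y => T u y beta) x) ->
  (forall s : 'I_r, differentiable (nth (cst 0) Ys s) x) ->
  'D_X (fun y => tensor_eval (T u y) [seq Y y | Y <- Ys]) x =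
  tensor_eval (cov_deriv g T u x) (X :: [seq Y x | Y <- Ys]) +
  \sum_(s < r) tensor_eval (T u x)
    (set_nth 0 [seq Y x | Y <- Ys] s (cov_deriv_vec g u X (nth (cst 0) Ys s) x)).
Proof.
move=> sz Tx Yx; set Y := [seq Z x | Z <- Ys].
have YE (s : 'I_r) (y : 'rV[R]_n) : nth 0 [seq Z y | Z <- Ys] s = nth (cst 0) Ys s y.
  by rewrite (nth_map (cst 0)) ?sz.
pose conn (s : 'I_r) := \row_b \sum_(a < n) \sum_(d < n)
  christoffel g u x b a d * X 0 a * (nth 0 Y s) 0 d : 'rV[R]_n.
have dT beta : is_derive x X (fun y => T u y beta) ('D_X (fun y => T u y beta) x).
  exact/derivableP/diff_derivable.
have dprod (beta : r.-tuple 'I_n) :=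
  is_derive_prod (fun s : 'I_r => derive_row X (tnth beta s) (Yx s)).
transitivity (\sum_(beta : r.-tuple 'I_n) (
    'D_X (fun y => T u y beta) x * (\prod_(s < r) (nth 0 Y s) 0 (tnth beta s)) +
    \sum_(s < r) T u x beta * (('D_X (nth (cst 0) Ys s) x) 0 (tnth beta s) *
      \prod_(t < r | t != s) (nth 0 Y t) 0 (tnth beta t)))).
  rewrite (_ : (fun y => _) = fun y => \sum_(beta : r.-tuple 'I_n)
    ((fun y => T u y beta) *
     (fun y => \prod_(s < r) (nth (cst 0) Ys s y) 0 (tnth beta s))) y); last first.
    apply/funext => y; apply: eq_bigr => beta _.
    by congr (_ * _); apply: eq_bigr => s _; rewrite YE.
  have := is_derive_bigsum (index_enum _)
    (fun beta => is_deriveM (dT beta) (dprod beta)).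
  move=> /@derive_val ->; apply: eq_bigr => beta _.
  rewrite /GRing.scale /= addrC mulrC; congr (_ * _ + _).
    by apply: eq_bigr => s _; rewrite YE.
  rewrite mulr_sumr; apply: eq_bigr => s _; congr (_ * (_ * _)).
  by apply: eq_bigr => t _; rewrite YE.
have -> : tensor_eval (cov_deriv g T u x) (X :: Y) =
    tensor_eval (fun beta => 'D_X (fun y => T u y beta) x) Y -
    \sum_(s < r) tensor_eval (T u x) (set_nth 0 Y s (conn s)).
  rewrite tensor_eval_cons.
  transitivity (tensor_eval (fun beta => 'D_X (fun y => T u y beta) x -
     \sum_(s < r) \sum_(d < n)
       (\sum_(a < n) christoffel g u x d a (tnth beta s) * X 0 a)
       * T u x (tuple_upd beta s d)) Y).
    under eq_bigr do rewrite mulr_sumr; rewrite exchange_big /=.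
    apply: eq_bigr => beta _.
    under eq_bigr do rewrite mulrA; rewrite -mulr_suml; congr (_ * _).
    rewrite derive_partial//.
    under [in RHS]eq_bigr => s _ do under eq_bigr => d _ do rewrite mulr_suml.
    under [in RHS]eq_bigr => s _ do rewrite exchange_big /=.
    rewrite exchange_big -sumrB /=; apply: eq_bigr => a _.
    rewrite cov_derivE mulrBr; congr (_ * _ - _).
    rewrite mulr_sumr; apply: eq_bigr => s _; rewrite mulr_sumr.
    by apply: eq_bigr => d _; rewrite mulrCA mulrA.
  rewrite /tensor_eval; under eq_bigr do rewrite mulrBl.
  rewrite sumrB; congr (_ - _).
  under eq_bigr do rewrite mulr_suml; rewrite exchange_big /=.
  apply: eq_bigr => s _.
  have := tensor_eval_contract (T u x)
    (fun d b => \sum_(a < n) christoffel g u x d a b * X 0 a) Y s.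
  rewrite /tensor_eval => ->; apply: eq_bigr => beta _; congr (_ * _).
  apply: eq_bigr => t _; congr ((nth 0 (set_nth 0 Y s _) t) 0 _).
  apply/rowP => b; rewrite !mxE exchange_big; apply: eq_bigr => d _.
  by rewrite mulr_suml.
rewrite -addrA -sumrN -big_split /= big_split /=; congr (_ + _).
rewrite exchange_big; apply: eq_bigr => s _.
rewrite !tensor_eval_set_nth -sumrN -big_split /=; apply: eq_bigr => beta _.
rewrite /cov_deriv_vec -YE -/(conn s) [(_ + conn s) _ _]mxE; ring.
Qed.

End Leibniz.

(** * Smoothness of the Christoffel symbols *)

Lemma near0_differentiable (R : realType) (V W : normedModType R) (f : V -> W) (x : V) :
  (\near x, f x = 0) -> differentiable f x.
Proof.
move=> f0.
have fE : f \o shift x = cst (f x) + \0 +o_ 0 id.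
  apply/eqaddoP => _ /posnumP[e].
  move: f0; rewrite (near_shift 0) subr0 => f0.
  have fx : f x = 0 by have := nbhs_singleton f0; rewrite /= add0r.
  near=> h; rewrite !fctE /= fx.
  rewrite [f (h + x)](near f0 h) // addr0 subrr normr0 mulr_ge0 //.
have d0 : 'd f x = \0 :> (V -> W) by apply: diff_unique fE => ?; exact: cst_continuous.
by apply/diff_locallyP; rewrite d0; split => // ?; exact: cst_continuous.
Unshelve. all: by end_near. Qed.

(** Needed because [invmx] is given by Cramer's rule only at invertible matrices,
hence only near the points of a chart image. *)
Lemma near_eq_differentiable (R : realType) (V W : normedModType R)
    (f g : V -> W) (x : V) :
  (\near x, f x = g x) -> differentiable f x -> differentiable g x.
Proof.
move=> fg fx; rewrite (_ : g = f + (g - f)); last by rewrite addrC subrK.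
apply: differentiableD => //; apply: near0_differentiable.
by apply: filterS fg => y fgy; rewrite !fctE fgy subrr.
Qed.

Section Smoothness.
Variables (R : realType) (n : nat) (M : smoothManifold R n) (g : tfield M 2).
Hypothesis hg : lorentzian_metric g.

Lemma near_chart_image (u : chart M) (x : 'rV[R]_n) : chart_image u x ->
  \forall y \near x, chart_image u y.
Proof. by move=> ux; apply: open_nbhs_nbhs; split => //; exact: chart_image_open. Qed.

Lemma differentiable_det m (A : 'rV[R]_n -> 'M[R]_m) (x : 'rV[R]_n) :
  (forall i j, differentiable (fun y => A y i j) x) ->
  differentiable (fun y => \det (A y)) x.
Proof.
move=> Ax; apply: differentiable_bigsum => s.
apply: differentiableM; first exact: differentiable_cst.
exact: differentiable_bigprod.
Qed.

Lemma differentiable_invmx m (A : 'rV[R]_n -> 'M[R]_m) (x : 'rV[R]_n) i j :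
  (forall i j, differentiable (fun y => A y i j) x) ->
  (\forall y \near x, A y \in unitmx) ->
  differentiable (fun y => invmx (A y) i j) x.
Proof.
move=> Ax Au; pose f y := (\det (A y))^-1 * cofactor (A y) j i.
apply: (near_eq_differentiable (f := f)).
  by near=> y; rewrite /invmx (near Au y)//= !mxE.
apply: differentiableM.
  apply: differentiableV; first exact: differentiable_det.
  by have := nbhs_singleton Au; rewrite unitmxE unitfE.
apply: differentiableM; first exact: differentiable_cst.
apply: differentiable_det => a b.
rewrite (_ : (fun y => _) = fun y => A y (lift j a) (lift i b)) //.
by apply/funext => y; rewrite !mxE.
Unshelve. all: by end_near. Qed.

Lemma differentiable_tensor r (T : tfield M r) (u : chart M) (x : 'rV[R]_n) beta :
  tensor_field T -> chart_image u x -> differentiable (fun y => T u y beta) x.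
Proof. by move=> hT ux; exact: (tensor_smooth hT beta [::] ux). Qed.

Lemma differentiable_partial_tensor r (T : tfield M r) (u : chart M)
    (x : 'rV[R]_n) a beta :
  tensor_field T -> chart_image u x ->
  differentiable (partial a (fun y => T u y beta)) x.
Proof. by move=> hT ux; exact: (tensor_smooth hT beta [:: a] ux). Qed.

Lemma differentiable_christoffel (u : chart M) (x : 'rV[R]_n) d a b :
  chart_image u x -> differentiable (fun y => christoffel g u y d a b) x.
Proof.
move=> ux; have gT := lorentzian_tensor hg.
apply: differentiableM; first exact: differentiable_cst.
apply: differentiable_bigsum => e; apply: differentiableM.
  apply: differentiable_invmx => [i j|].
    rewrite (_ : (fun y => _) = fun y => g u y [tuple i; j]).
      exact: differentiable_tensor.
    by apply/funext => y; rewrite mxE.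
  apply: filterS (near_chart_image ux) => y; exact: gram_unit.
apply: differentiableB; first apply: differentiableD;
  exact: differentiable_partial_tensor.
Qed.

Lemma differentiable_cov_deriv r (T : tfield M r) (u : chart M) (x : 'rV[R]_n) alpha :
  tensor_field T -> chart_image u x ->
  differentiable (fun y => cov_deriv g T u y alpha) x.
Proof.
move=> hT ux; apply: differentiableB; first exact: differentiable_partial_tensor.
apply: differentiable_bigsum => s; apply: differentiable_bigsum => d.
apply: differentiableM; first exact: differentiable_christoffel.
exact: differentiable_tensor.
Qed.

End Smoothness.

(** * The boost filtration of the tangent space *)

Section BoostFiltration.
Variables (R : realType) (n : nat).

Definition index_weight (i : 'I_n) : int := (i == 0%N :> nat)%:Z - (i == 1%N :> nat)%:Z.

(** The span of the frame vectors of boost weight at least [w]: everything for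
[w <= -1], the orthogonal of the null line for [w = 0], the line for [w = 1]. *)
Definition boost_filtration (e : 'M[R]_n) (w : int) : set 'rV[R]_n :=
  [set X | forall i, index_weight i < w -> (X *m invmx e) 0 i = 0].

Lemma boost_weightE r (alpha : r.-tuple 'I_n) :
  boost_weight alpha = \sum_(s < r) index_weight (tnth alpha s).
Proof.
have countE (p : pred 'I_n) : (count p alpha)%:Z = \sum_(s < r) (p (tnth alpha s))%:Z.
  rewrite -(big_tuple _ _ alpha predT (fun i => (p i)%:Z)).
  by elim: (tval alpha) => [|i s IHs]; rewrite ?big_nil// big_cons /= PoszD IHs.
by rewrite sumrB /boost_weight !countE.
Qed.

(** Multilinearity: each argument is expanded in the basis [e]. *)
Lemma tensor_eval_frame r (e : 'M[R]_n) (T : r.-tuple 'I_n -> R) (Ys : seq 'rV[R]_n) :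
  e \in unitmx ->
  tensor_eval T Ys = \sum_(alpha : r.-tuple 'I_n)
    frame_comp e T alpha * \prod_(s < r) (nth 0 Ys s *m invmx e) 0 (tnth alpha s).
Proof.
move=> eu; pose xi (t : 'I_r) i := (nth 0 Ys t *m invmx e) 0 i.
under [RHS]eq_bigr do rewrite mulr_suml.
rewrite exchange_big; apply: eq_bigr => beta _ /=.
under [RHS]eq_bigr do rewrite -mulrA -big_split /=.
rewrite -mulr_sumr; congr (_ * _).
transitivity (\prod_(t < r) \sum_(i < n) e i (tnth beta t) * xi t i).
  apply: eq_bigr => t _.
  rewrite -{1}(mulmxKV eu (nth 0 Ys t)) mxE; apply: eq_bigr => i _; exact: mulrC.
rewrite bigA_distr_bigA.
rewrite (reindex (fun f : {ffun 'I_r -> 'I_n} => [tuple f t | t < r])) /=.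
  by apply: eq_bigr => f _; apply: eq_bigr => t _; rewrite tnth_mktuple.
exists (fun alpha : r.-tuple 'I_n => [ffun t => tnth alpha t]) => [f _|alpha _].
  by apply/ffunP => t; rewrite ffunE tnth_mktuple.
by apply: eq_from_tnth => t; rewrite tnth_mktuple ffunE.
Qed.

(** In the expansion over multi-indices, a multi-index of total weight at most [s]
has some entry of weight below [w t], where the [t]-th argument has no
coordinate. *)
Lemma bo_le_tensor_eval0 r (G : 'M[R]_n) (L : set 'rV[R]_n)
    (T : r.-tuple 'I_n -> R) (s : int) (e : 'M[R]_n)
    (w : 'I_r -> int) (Ys : seq 'rV[R]_n) :
  bo_le G L T s -> null_frame G L e ->
  (forall t : 'I_r, boost_filtration e (w t) (nth 0 Ys t)) -> s < \sum_t w t ->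
  tensor_eval T Ys = 0.
Proof.
move=> Tbo fe wY sw; have [eu _ _] := fe.
rewrite (tensor_eval_frame _ _ eu) big1 // => alpha _.
have [->|Ta0] := eqVneq (frame_comp e T alpha) 0; first by rewrite mul0r.
have [t tw] : exists t, index_weight (tnth alpha t) < w t.
  apply/not_existsP => /= aw.
  have := Tbo _ fe _ Ta0; rewrite boost_weightE leNgt => /negP; apply.
  apply: lt_le_trans sw _; apply: ler_sum => t _.
  by rewrite leNgt; apply/negP.
by rewrite (bigD1 t)//= (wY t) // mul0r mulr0.
Qed.

End BoostFiltration.

(** * Rank two tensors as bilinear forms *)

Section Inner.
Variables (R : realType) (n : nat) (M : smoothManifold R n).
Variables (T : tfield M 2) (u : chart M) (x : 'rV[R]_n).
Implicit Types X Y Z : 'rV[R]_n.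

Lemma inner_tensor_eval X Y : tensor_eval (T u x) [:: X; Y] = inner T u x X Y.
Proof.
rewrite tensor_eval2 /inner -mulmxA mxE; apply: eq_bigr => a _.
rewrite mxE mulr_sumr; apply: eq_bigr => b _; rewrite !mxE; ring.
Qed.

Lemma innerBl X Y Z : inner T u x (X - Y) Z = inner T u x X Z - inner T u x Y Z.
Proof. by rewrite /inner !mulmxBl; rewrite !mxE. Qed.

Lemma innerZl a X Y : inner T u x (a *: X) Y = a * inner T u x X Y.
Proof. by rewrite /inner -!scalemxAl [LHS]mxE. Qed.

Lemma innerZr a X Y : inner T u x X (a *: Y) = a * inner T u x X Y.
Proof. by rewrite /inner linearZ -scalemxAr [LHS]mxE. Qed.

Lemma inner_sym X Y : symmetric2 T -> chart_image u x ->
  inner T u x X Y = inner T u x Y X.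
Proof.
move=> Tsym ux; rewrite -!inner_tensor_eval !tensor_eval2 exchange_big.
apply: eq_bigr => a _; apply: eq_bigr => b _.
by rewrite Tsym// mulrC [Y 0 _ * _]mulrC mulrC.
Qed.

End Inner.

Section DerivativeOfInner.
Variables (R : realType) (n : nat) (M : smoothManifold R n) (g : tfield M 2).
Variables (u : chart M) (x : 'rV[R]_n).
Implicit Types (X : 'rV[R]_n) (Y Z : 'rV[R]_n -> 'rV[R]_n).

Lemma derive_inner (T : tfield M 2) X Y Z :
  tensor_field T -> chart_image u x -> differentiable Y x -> differentiable Z x ->
  'D_X (fun y => inner T u y (Y y) (Z y)) x =
  tensor_eval (cov_deriv g T u x) [:: X; Y x; Z x] +
  (inner T u x (cov_deriv_vec g u X Y x) (Z x) +
   inner T u x (Y x) (cov_deriv_vec g u X Z x)).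
Proof.
move=> hT ux Yx Zx.
have := derive_tensor_eval g (T := T) (u := u) (Ys := [:: Y; Z]) (x := x) X erefl.
rewrite !big_ord_recl big_ord0 addr0 /= !inner_tensor_eval => <-.
- by congr ('D_X _ x); apply/funext => y; rewrite inner_tensor_eval.
- by move=> beta; exact: differentiable_tensor.
- by case=> -[|[]].
Qed.

Lemma derive_metric X Y Z :
  lorentzian_metric g -> chart_image u x -> differentiable Y x -> differentiable Z x ->
  'D_X (fun y => inner g u y (Y y) (Z y)) x =
  inner g u x (cov_deriv_vec g u X Y x) (Z x) +
  inner g u x (Y x) (cov_deriv_vec g u X Z x).
Proof.
move=> hg ux Yx Zx; rewrite derive_inner //; last exact: lorentzian_tensor.
rewrite [tensor_eval _ _]big1 ?add0r // => alpha _.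
by rewrite cov_deriv_metric // mul0r.
Qed.

Lemma differentiable_inner (T : tfield M 2) Y Z :
  tensor_field T -> chart_image u x -> differentiable Y x -> differentiable Z x ->
  differentiable (fun y => inner T u y (Y y) (Z y)) x.
Proof.
move=> hT ux Yx Zx.
rewrite (_ : (fun y => _) = fun y => tensor_eval (T u y) [seq W y | W <- [:: Y; Z]]).
  apply: differentiable_tensor_eval => // [beta|]; first exact: differentiable_tensor.
  by case=> -[|[]].
by apply/funext => y /=; rewrite inner_tensor_eval.
Qed.

Lemma derive_near0 (f : 'rV[R]_n -> R) X : (\near x, f x = 0) -> 'D_X f x = 0.
Proof. by move=> f0; rewrite (near_eq_derive (g := cst 0)) // derive_cst. Qed.

End DerivativeOfInner.

(** * Null frames *)

Section NullFrame.
Variables (R : realType) (n : nat) (i0 i1 : 'I_n).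
Hypotheses (i0E : i0 = 0%N :> nat) (i1E : i1 = 1%N :> nat).
Variables (G : 'M[R]_n) (L : set 'rV[R]_n) (e : 'M[R]_n).
Hypothesis fe : null_frame G L e.
Implicit Types X Y : 'rV[R]_n.

Local Notation coord X i := ((X *m invmx e) 0 i).

(** The Gram matrix of a null frame is the permutation matrix that exchanges the
first two frame vectors. *)
Lemma inner_null_frame X Y :
  (X *m G *m Y^T) 0 0 = \sum_i coord X i * coord Y (tperm i0 i1 i).
Proof.
have [eu _ eG] := fe.
rewrite -{1}(mulmxKV eu X) -{1}(mulmxKV eu Y).
set X' := X *m _; set Y' := Y *m _.
rewrite trmx_mul !mulmxA -(mulmxA X') -(mulmxA X') eG.
rewrite -mulmxA mxE; apply: eq_bigr => i _; congr (_ * _).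
rewrite mxE (bigD1 (tperm i0 i1 i)) //= big1 ?addr0 => [|j ji].
  rewrite !mxE; case: tpermP => [->|->|/eqP ii0 /eqP ii1].
  - by rewrite i0E i1E /= mul1r.
  - by rewrite i0E i1E /= mul1r.
  - rewrite -!val_eqE /= i0E i1E in ii0 ii1; rewrite eqxx.
    by rewrite ltn_neqAle [1%N == _]eq_sym ii1 lt0n ii0 /= !orbT mul1r.
rewrite !mxE (_ : [|| _, _ | _] = false) ?mul0r //.
have E0 (k : 'I_n) : (k == 0%N :> nat) = (k == i0) by rewrite -[k == i0]val_eqE /= i0E.
have E1 (k : 'I_n) : (k == 1%N :> nat) = (k == i1) by rewrite -[k == i1]val_eqE /= i1E.
move: ji; rewrite !E0 !E1.
case: tpermP => [->|->|/eqP ii0 /eqP ii1] ji; rewrite ?eqxx.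
- by rewrite (negbTE ji) -[i0 == i1]val_eqE /= i0E i1E.
- by rewrite (negbTE ji) -[i1 == i0]val_eqE /= i0E i1E.
- by rewrite (negbTE ii0) (negbTE ii1) /= eq_sym (negbTE ji) andbF.
Qed.

Lemma coord_row i j : coord (row i e) j = (i == j)%:R.
Proof. by have [eu _ _] := fe; rewrite -row_mul mulmxV // !mxE. Qed.

Lemma inner_row0 X : (X *m G *m (row i0 e)^T) 0 0 = coord X i1.
Proof.
rewrite inner_null_frame (bigD1 i1) //= big1 ?addr0 => [|i ii1].
  by rewrite tpermR coord_row eqxx mulr1.
rewrite coord_row -{1}(tpermR i0 i1) (inj_eq perm_inj) eq_sym (negbTE ii1).
by rewrite mulr0.
Qed.

Lemma row_neq0 i : row i e != 0.
Proof.
apply/eqP => r0; have := coord_row i i.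
by rewrite r0 mul0mx mxE eqxx => /eqP; rewrite eq_sym oner_eq0.
Qed.

Lemma filtrationN1 X : boost_filtration e (-1) X.
Proof. by move=> i; rewrite /index_weight; do 2![case: eqP => //]. Qed.

Lemma filtration0 X :
  (X *m G *m (row i0 e)^T) 0 0 = 0 -> boost_filtration e 0 X.
Proof.
rewrite inner_row0 => X1 i; rewrite /index_weight.
have [ii1 _|_] := eqVneq (i : nat) 1%N; last by case: eqP.
by rewrite (_ : i = i1) //; apply: val_inj; rewrite /= i1E.
Qed.

Lemma filtration1 : boost_filtration e 1 (row i0 e).
Proof.
move=> i; rewrite /index_weight coord_row -[i0 == i]val_eqE /= i0E eq_sym /=.
by case: (nat_of_ord i).
Qed.

(** The orthogonal of the null vector is spanned by this vector and the spacelike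
frame vectors, so the metric is positive semi-definite on it, with the null line
as radical. *)
Section Orthogonal.
Variable X : 'rV[R]_n.
Hypothesis Xk : (X *m G *m (row i0 e)^T) 0 0 = 0.

Let inner_sq : (X *m G *m X^T) 0 0 = \sum_(i | i \notin [:: i0; i1]) coord X i ^+ 2.
Proof.
have X1 : coord X i1 = 0 by rewrite -inner_row0.
have i01 : i1 != i0 by rewrite -val_eqE /= i0E i1E.
rewrite inner_null_frame (bigD1 i0) //= tpermL X1 mulr0 add0r.
rewrite (bigD1 i1) //= X1 mul0r add0r; apply: eq_big => [i|i /andP[ii0 ii1]].
  by rewrite !inE negb_or.
by rewrite tpermD 1?eq_sym // expr2.
Qed.

Lemma inner_orth_ge0 : 0 <= (X *m G *m X^T) 0 0.
Proof. by rewrite inner_sq; apply: sumr_ge0 => i _; exact: sqr_ge0. Qed.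

Lemma inner_orth_eq0 : (X *m G *m X^T) 0 0 = 0 -> exists a, X = a *: row i0 e.
Proof.
have [eu _ _] := fe.
move=> XX0; exists (coord X i0); rewrite -{1}(mulmxKV eu X) {1}[X *m _]row_sum_delta.
have X1 : coord X i1 = 0 by rewrite -inner_row0.
rewrite (bigD1 i0) //= mulmxDl -scalemxAl -rowE mulmx_suml big1 ?addr0 // => i ii0.
have [->|ii1] := eqVneq i i1; first by rewrite X1 scale0r mul0mx.
move: XX0; rewrite inner_sq => /eqP; rewrite psumr_eq0 => [|j _]; last exact: sqr_ge0.
move=> /allP /(_ i (mem_index_enum i)); rewrite !inE negb_or ii0 ii1 /= sqrf_eq0.
by move=> /eqP ->; rewrite scale0r mul0mx.
Qed.

End Orthogonal.
End NullFrame.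

(** * Type III tensors along a null congruence *)

Section TypeIII.
Variables (R : realType) (n : nat) (hn : (3 <= n)%N).
Variables (M : smoothManifold R n) (g : tfield M 2) (hg : lorentzian_metric g).
Variables (c : distribution_field M) (hc : null_congruence g c).
Variables (S : tfield M 2) (hS : tensor_field S) (hSsym : symmetric2 S).
Hypothesis hSbo : field_bo_eq g c S (-1).
Variables (u : chart M) (V : set 'rV[R]_n) (k : 'rV[R]_n -> 'rV[R]_n).
Hypothesis hk : local_section c u V k.
Implicit Types (x y X Y Z W l : 'rV[R]_n).

Let i0 : 'I_n := Ordinal (ltnW (ltnW hn)).
Let i1 : 'I_n := Ordinal (ltnW hn).
Let i0E : i0 = 0%N :> nat. Proof. by []. Qed.
Let i1E : i1 = 1%N :> nat. Proof. by []. Qed.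

Local Notation "T ⟪ X , Y ⟫_ x" := (inner T u x X Y)
  (at level 2, x at level 2, format "T ⟪ X ,  Y ⟫_ x").
Local Notation kappa x X := (cov_deriv_vec g u X k x).

Lemma section_chart x : V x -> chart_image u x.
Proof. by case: hk => _ VU _ _; exact: VU. Qed.

Lemma section_differentiable x : V x -> differentiable k x.
Proof. by case: hk => _ _ ks _ Vx; exact: (ks [::] x Vx). Qed.

Lemma section_near x : V x -> \forall y \near x, V y.
Proof. by case: hk => oV _ _ _ Vx; exact: open_nbhs_nbhs. Qed.

(** [c] is spanned near the point by some section, of which [k] is a nonzero
multiple. *)
Lemma section_spans x X : V x -> c u x X -> exists a, X = a *: k x.
Proof.
case: hk => _ VU _ hV Vx cX; have [k0 ck] := hV x Vx.
have [V' [k' [V'x _ hV']]] := congruence_line hc (VU x Vx).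
move: cX ck; rewrite (hV' x V'x) => -[a _ <-] [b _ bk]; exists (a / b).
rewrite -bk scalerA mulfVK //; apply: contra_neq k0 => b0.
by rewrite -bk b0 scale0r.
Qed.

Lemma section_frame e x : V x -> null_frame (gram g u x) (c u x) e ->
  exists2 t, t != 0 & row i0 e = t *: k x.
Proof.
move=> Vx fe; have [_ ce _] := fe.
have [t et] := section_spans Vx (ce i0 i0E); exists t => //.
have : row i0 e != 0 by apply: row_neq0 fe i0.
by apply: contra_neq => t0; rewrite et t0 scale0r.
Qed.

Lemma section_null x : V x -> g⟪k x, k x⟫_x = 0.
Proof.
move=> Vx; case: hk => _ VU _ hV; have [_ ck] := hV x Vx.
exact: (congruence_null hc (VU x Vx)).
Qed.

Lemma metricC x X Y : V x -> g⟪X, Y⟫_x = g⟪Y, X⟫_x.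
Proof. by move=> Vx; apply: inner_sym (section_chart Vx); exact: lorentzian_sym. Qed.

Lemma typeIIIC x X Y : V x -> S⟪X, Y⟫_x = S⟪Y, X⟫_x.
Proof. by move=> Vx; exact: inner_sym (section_chart Vx). Qed.

Lemma exists_frame x : V x -> exists e, null_frame (gram g u x) (c u x) e.
Proof.
by move=> Vx; have [_ [e [_ [fe _ _]]]] := hSbo (section_chart Vx); exists e.
Qed.

(** [boost_filtration] described by [k] instead of a null frame; at level 1 the
vector [k] itself is enough. *)
Definition section_level (x : 'rV[R]_n) (w : int) : set 'rV[R]_n :=
  [set X | w <= -1 \/ (w <= 0 /\ g⟪X, k x⟫_x = 0) \/ (w <= 1 /\ X = k x)].

Lemma section_bo_le r (T : tfield M r) s (w : seq int) (Ys : seq 'rV[R]_n) x :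
  V x -> bo_le (gram g u x) (c u x) (T u x) s ->
  (forall t : 'I_r, section_level x (nth 0 w t) (nth 0 Ys t)) ->
  s < \sum_(t < r) nth 0 w t -> tensor_eval (T u x) Ys = 0.
Proof.
move=> Vx Tbo wY sw; have [e fe] := exists_frame Vx.
have [t t0 et] := section_frame Vx fe.
apply: (bo_le_tensor_eval0 (w := fun s => nth 0 w s) Tbo fe) => // j.
have mono (w1 w2 : int) X :
    w1 <= w2 -> boost_filtration e w2 X -> boost_filtration e w1 X.
  by move=> w12 wX i iw; apply: wX; exact: lt_le_trans w12.
have [w1|[[w0 Yk]|[w1 Yk]]] := wY j.
- exact: mono w1 (filtrationN1 _ _).
- apply: mono w0 _; apply: (filtration0 i0E i1E fe).
  by rewrite et -[LHS]/(inner g u x _ _) innerZr Yk mulr0.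
- apply: mono w1 _ => i i1'; rewrite Yk -(scalerK t0 (k x)) -et.
  by rewrite -scalemxAl mxE (filtration1 i0E fe) // mulr0.
Qed.

Lemma orth_ge0 x X : V x -> g⟪X, k x⟫_x = 0 -> 0 <= g⟪X, X⟫_x.
Proof.
move=> Vx Xk; have [e fe] := exists_frame Vx.
have [t t0 et] := section_frame Vx fe.
apply: (inner_orth_ge0 i0E i1E fe).
by rewrite et -[LHS]/(inner g u x _ _) innerZr Xk mulr0.
Qed.

Lemma orth_null x X : V x -> g⟪X, k x⟫_x = 0 -> g⟪X, X⟫_x = 0 ->
  exists a, X = a *: k x.
Proof.
move=> Vx Xk XX; have [e fe] := exists_frame Vx.
have [t t0 et] := section_frame Vx fe.
have [||a ->] := inner_orth_eq0 i0E i1E fe (X := X) => //.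
  by rewrite et -[LHS]/(inner g u x _ _) innerZr Xk mulr0.
by exists (a * t); rewrite et scalerA.
Qed.

Lemma typeIII_section x Z : V x -> S⟪Z, k x⟫_x = 0.
Proof.
move=> Vx; rewrite -inner_tensor_eval.
have [Sbo _] := hSbo (section_chart Vx).
apply: (section_bo_le (w := [:: -1; 1]) Vx Sbo).
  by case=> -[|[|[]]] //= _; [left | right; right].
by rewrite !big_ord_recl big_ord0.
Qed.

Lemma typeIII_orth x Y Z : V x -> g⟪Y, k x⟫_x = 0 -> g⟪Z, k x⟫_x = 0 ->
  S⟪Y, Z⟫_x = 0.
Proof.
move=> Vx Yk Zk; rewrite -inner_tensor_eval.
have [Sbo _] := hSbo (section_chart Vx).
apply: (section_bo_le (w := [:: 0; 0]) Vx Sbo).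
  by case=> -[|[|[]]] //= _; right; left.
by rewrite !big_ord_recl big_ord0.
Qed.

Lemma exists_conjugate x : V x -> exists l, g⟪l, k x⟫_x = 1.
Proof.
move=> Vx; case: hk => _ VU _ hV; have [k0 _] := hV x Vx.
have kG0 : gram g u x *m (k x)^T != 0.
  apply: contra_neq k0 => kG; apply: trmx_inj; rewrite trmx0.
  by rewrite -(mulKmx (gram_unit hg (VU x Vx)) (k x)^T) kG mulmx0.
have [i ki] := cV0Pn _ kG0.
exists (((gram g u x *m (k x)^T) i 0)^-1 *: delta_mx 0 i).
by rewrite innerZl /inner -mulmxA -rowE [(row _ _) _ _]mxE mulVf.
Qed.

(** [W - g(W, k) l] is orthogonal to [k]. *)
Lemma typeIII_split x l W Z : V x -> g⟪l, k x⟫_x = 1 -> g⟪Z, k x⟫_x = 0 ->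
  S⟪W, Z⟫_x = g⟪W, k x⟫_x * S⟪l, Z⟫_x.
Proof.
move=> Vx lk Zk; apply/eqP; rewrite -subr_eq0 -innerZl -innerBl; apply/eqP.
by apply: typeIII_orth => //; rewrite innerBl innerZl lk mulr1 subrr.
Qed.

(** The dual [v] of [S(l, .)] is orthogonal to [k] because [S(l, k) = 0]. If it were
null it would be a multiple of [k], so [S(l, .)], and then [S], would vanish on the
orthogonal of [k]; but a component of boost weight -1 has an argument there. *)
Lemma exists_spacelike x l : V x -> g⟪l, k x⟫_x = 1 ->
  exists v, [/\ g⟪v, k x⟫_x = 0, 0 < g⟪v, v⟫_x &
                forall Z, S⟪l, Z⟫_x = g⟪v, Z⟫_x].
Proof.
move=> Vx lk; have ux := section_chart Vx.
pose v := l *m gram S u x *m invmx (gram g u x).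
have vS Z : S⟪l, Z⟫_x = g⟪v, Z⟫_x by rewrite /inner mulmxKV // gram_unit.
have vk : g⟪v, k x⟫_x = 0 by rewrite -vS typeIII_section.
exists v; split=> //; rewrite lt0r orth_ge0 // andbT; apply/eqP => vv.
have [a va] := orth_null Vx vk vv.
have Sperp W Z : g⟪Z, k x⟫_x = 0 -> S⟪W, Z⟫_x = 0.
  move=> Zk; rewrite (typeIII_split W Vx lk Zk) vS va innerZl.
  by rewrite [g⟪k x, Z⟫_x]metricC // Zk !mulr0.
have [_ [e [alpha [fe Sa wa]]]] := hSbo ux.
have [t t0 et] := section_frame Vx fe.
have row_orth i : i != i1 -> g⟪row i e, k x⟫_x = 0.
  move=> ii1; rewrite -(scalerK t0 (k x)) -et innerZr.
  rewrite [g⟪_, _⟫_x](inner_row0 i0E i1E fe) (coord_row fe) (negbTE ii1) /=.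
  by rewrite mulr0.
move: Sa wa; rewrite frame_compE boost_weightE !big_ord_recl big_ord0.
case/tupleP: alpha => a0 /= alpha; case/tupleP: alpha => a1 alpha.
rewrite (tuple0 alpha) /= inner_tensor_eval.
have [-> |/row_orth a1k] := eqVneq a1 i1; last by rewrite Sperp // eqxx.
have [-> |/row_orth a0k] := eqVneq a0 i1; first by [].
by rewrite typeIIIC // Sperp // eqxx.
Qed.

(** Derivative of [g(k, k) = 0]. *)
Lemma cov_section_orth x X : V x -> g⟪kappa x X, k x⟫_x = 0.
Proof.
move=> Vx; have kx := section_differentiable Vx.
have := derive_metric X hg (section_chart Vx) kx kx.
rewrite derive_near0; last first.
  by apply: filterS (section_near Vx) => y; exact: section_null.
by rewrite [g⟪k x, _⟫_x]metricC // => /esym; lra.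
Qed.

(** Derivative of [S(W, k) = 0] for the field [W] with constant coordinates; the
term with the derivative of [W] vanishes since [S(., k) = 0]. *)
Lemma nablaS_section x X W : V x ->
  tensor_eval (cov_deriv g S u x) [:: X; W; k x] = - S⟪W, kappa x X⟫_x.
Proof.
move=> Vx; have kx := section_differentiable Vx.
have := derive_inner g X hS (section_chart Vx) (@differentiable_cst _ _ _ W x) kx.
rewrite derive_near0; last first.
  by apply: filterS (section_near Vx) => y; exact: typeIII_section.
by rewrite typeIII_section // add0r => /esym /eqP; rewrite addr_eq0 => /eqP.
Qed.

(** A vector field orthogonal to [k] wherever [k] is defined; at a point where
[g(l, k) = 1] it extends every [X] orthogonal to [k]. *)
Definition orth_ext l X (y : 'rV[R]_n) : 'rV[R]_n :=
  g⟪l, k y⟫_y *: X - g⟪X, k y⟫_y *: l.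

Lemma orth_ext_orth l X y : V y -> g⟪orth_ext l X y, k y⟫_y = 0.
Proof. by move=> Vy; rewrite innerBl !innerZl mulrC subrr. Qed.

Lemma orth_extE l X x :
  g⟪l, k x⟫_x = 1 -> g⟪X, k x⟫_x = 0 -> orth_ext l X x = X.
Proof. by rewrite /orth_ext => -> ->; rewrite scale1r scale0r subr0. Qed.

Lemma differentiable_orth_ext l X x : V x -> differentiable (orth_ext l X) x.
Proof.
move=> Vx; have ux := section_chart Vx; have kx := section_differentiable Vx.
by apply: differentiableB; apply: differentiableZl; apply: differentiable_inner => //;
  exact: lorentzian_tensor.
Qed.

(** Derivative of [g(orth_ext l Y, k) = 0]. *)
Lemma cov_orth_ext_section l X Y x :
  V x -> g⟪l, k x⟫_x = 1 -> g⟪Y, k x⟫_x = 0 ->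
  g⟪cov_deriv_vec g u X (orth_ext l Y) x, k x⟫_x = - g⟪Y, kappa x X⟫_x.
Proof.
move=> Vx lk Yk; have kx := section_differentiable Vx.
have := derive_metric X hg (section_chart Vx) (differentiable_orth_ext l Y Vx) kx.
rewrite derive_near0; last first.
  by apply: filterS (section_near Vx) => y; exact: orth_ext_orth.
by rewrite orth_extE // => /esym /eqP; rewrite addr_eq0 => /eqP.
Qed.

(** Derivative of [S(Y, Z) = 0] for the extensions of [Y] and [Z] to fields
orthogonal to [k]. *)
Lemma nablaS_orth x l X Y Z : V x -> g⟪l, k x⟫_x = 1 ->
  g⟪Y, k x⟫_x = 0 -> g⟪Z, k x⟫_x = 0 ->
  tensor_eval (cov_deriv g S u x) [:: X; Y; Z] =
  g⟪Y, kappa x X⟫_x * S⟪l, Z⟫_x + g⟪Z, kappa x X⟫_x * S⟪l, Y⟫_x.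
Proof.
move=> Vx lk Yk Zk.
have := derive_inner g X hS (section_chart Vx) (differentiable_orth_ext l Y Vx)
  (differentiable_orth_ext l Z Vx).
rewrite derive_near0; last first.
  apply: filterS (section_near Vx) => y Vy.
  by apply: typeIII_orth => //; exact: orth_ext_orth.
rewrite !orth_extE // (typeIII_split _ Vx lk Zk) [S⟪Y, _⟫_x]typeIIIC //.
rewrite (typeIII_split _ Vx lk Yk) !cov_orth_ext_section //; lra.
Qed.

(** At the spacelike [Z] dual to [S(l, .)], the two terms of the identity are
nonnegative. *)
Lemma cov_section_proportional x l X : V x -> g⟪l, k x⟫_x = 1 ->
  (forall Z, g⟪Z, k x⟫_x = 0 ->
    2 * (g⟪Z, kappa x X⟫_x * S⟪l, kappa x X⟫_x) +
    g⟪kappa x X, kappa x X⟫_x * S⟪l, Z⟫_x = 0) ->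
  exists a, kappa x X = a *: k x.
Proof.
move=> Vx lk H; have [v [vk vv vS]] := exists_spacelike Vx lk.
apply: orth_null => //; first exact: cov_section_orth.
have := H v vk; rewrite !vS => E.
have := orth_ge0 Vx (cov_section_orth X Vx).
nra.
Qed.

(** [(nabla_k S)(Y, W)] has boost weight at least 1 when [Y] and [W] are orthogonal
to [k]. *)
Lemma section_geodetic x : V x -> field_bo_le g c (cov_deriv g S) 0 ->
  exists a, kappa x (k x) = a *: k x.
Proof.
move=> Vx Tbo; have [l lk] := exists_conjugate Vx.
apply: (cov_section_proportional Vx lk) => Z Zk.
have Tk Y W : g⟪Y, k x⟫_x = 0 -> g⟪W, k x⟫_x = 0 ->
    g⟪Y, kappa x (k x)⟫_x * S⟪l, W⟫_x +
    g⟪W, kappa x (k x)⟫_x * S⟪l, Y⟫_x = 0.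
  move=> Yk Wk; rewrite -nablaS_orth //.
  apply: (section_bo_le (w := [:: 1; 0; 0]) Vx (Tbo _ _ (section_chart Vx))).
    by case=> -[|[|[|[]]]] //= _; right; [right | left..].
  by rewrite !big_ord_recl big_ord0.
have kk := cov_section_orth (k x) Vx.
have := Tk _ _ kk Zk; have := Tk _ _ kk kk.
have [->|t0 /eqP] := eqVneq (S⟪l, kappa x (k x)⟫_x) 0; first by lra.
rewrite -mulr2n mulrn_eq0 /= mulf_eq0 (negbTE t0) orbF => /eqP ->; lra.
Qed.

(** Leibniz rule for [(nabla_X S)(Z, k)], with [X] constant in the chart and [Z]
extended to a field orthogonal to [k], so that this function vanishes near the
point. *)
Lemma section_kundt x X : V x -> field_bo_le g c (cov_deriv g (cov_deriv g S)) 0 ->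
  g⟪X, k x⟫_x = 0 -> exists a, kappa x X = a *: k x.
Proof.
move=> Vx Ubo Xk; have [l lk] := exists_conjugate Vx.
have ux := section_chart Vx; have kx := section_differentiable Vx.
apply: (cov_section_proportional Vx lk) => Z Zk.
have := derive_tensor_eval g (T := cov_deriv g S) (u := u) (x := x)
  (Ys := [:: cst X; orth_ext l Z; k]) X erefl.
rewrite derive_near0; last first.
  apply: filterS (section_near Vx) => y Vy /=.
  rewrite nablaS_section // typeIII_orth ?oppr0 //; first exact: orth_ext_orth.
  exact: cov_section_orth.
rewrite !big_ord_recl big_ord0 addr0 /= orth_extE // !nablaS_section //.
rewrite (nablaS_orth _ Vx lk) //; last exact: cov_section_orth.
rewrite (typeIII_orth Vx Zk (cov_section_orth _ Vx)).
rewrite (typeIII_split _ Vx lk (cov_section_orth _ Vx)) cov_orth_ext_section //.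
rewrite (section_bo_le (w := [:: 0; 0; 0; 1]) Vx (Ubo _ _ ux)); last 2 first.
- by case=> -[|[|[|[|[]]]]] //= _; right; [left.. | right].
- by rewrite !big_ord_recl big_ord0.
move=> E; suff : (forall beta, differentiable ((cov_deriv g S u)^~ beta) x) /\
    (forall s : 'I_3, differentiable (nth (cst 0) [:: cst X; orth_ext l Z; k] s) x).
  by move=> [/E {}E /E]; lra.
split=> [beta|]; first exact: differentiable_cov_deriv.
by case=> -[|[|[|[]]]] //= _; exact: differentiable_orth_ext.
Qed.

End TypeIII.

Theorem proposition2 (R : realType) (n : nat) (hn : (3 <= n)%N)
    (M : smoothManifold R n)
    (g : tfield M 2) (hg : lorentzian_metric g)
    (c : distribution_field M) (hc : null_congruence g c)
    (S : tfield M 2) (hS : tensor_field S) (hSsym : symmetric2 S)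
    (hSbo : field_bo_eq g c S (-1)) :
  (field_bo_le g c (cov_deriv g S) 0 -> geodetic g c) /\
  (field_bo_le g c (cov_deriv g S) 0 ->
   field_bo_le g c (cov_deriv g (cov_deriv g S)) 0 -> kundt g c).
Proof.
split=> [Tbo u V k hk x Vx | _ Ubo u V k hk x Vx X Xc].
  exact: (section_geodetic hn hg hc hS hSsym hSbo hk Vx Tbo).
apply: (section_kundt hn hg hc hS hSsym hSbo hk Vx Ubo).
by case: hk => _ _ _ hV; apply: Xc; case: (hV x Vx).
Qed.
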